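(* For any connected graphs $G$ and $H$, $$\mathrm{diam}_{\min}(G\boxtimes H)\le 2\,\mathrm{rad}(G\boxtimes H)+15 .$$
   Context: Graphs are finite, simple and undirected. The strong product $G\boxtimes H$ of graphs $G$ and $H$ has vertex set $V(G)\times V(H)$; vertices $(x_1,y_1)$ and $(x_2,y_2)$ are adjacent iff $x_1=x_2$ and $y_1y_2\in E(H)$, or $x_1x_2\in E(G)$ and $y_1=y_2$, or $x_1x_2\in E(G)$ and $y_1y_2\in E(H)$. An orientation of a graph $G$ is a digraph obtained by giving each edge of $G$ exactly one of its two directions. A digraph $D$ is strongly connected (strong) if for all vertices $u,v$ there is a directed path from $u$ to $v$. The distance $\mathrm{dist}(u,v)$ in $D$ is the length (number of arcs) of a shortest directed path from $u$ to $v$ ($\infty$ if none exists), and $\mathrm{diam}(D)=\max\{\mathrm{dist}(u,v) : u,v\in V(D)\}$. For an undirected graph $G$, $\mathrm{diam}_{\min}(G)=\min\{\mathrm{diam}(D) : D \text{ is a strong orientation of } G\}$. The eccentricity of a vertex $x$ of an undirected connected graph is the maximum distance from $x$ to a vertex, and the radius $\mathrm{rad}(G)$ is the minimum eccentricity over all vertices of $G$.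
   Formalization: Both G and H are assumed to have at least two vertices; with a one-vertex factor the claim fails, e.g. the strong product of K_1 and K_2 is a single edge, which has no strong orientation. *)

(* Defs.v *)
From HB Require Import structures.
From mathcomp Require Import all_boot all_order all_algebra.
From mathcomp Require Import constructive_ereal.

Set Implicit Arguments.
Unset Strict Implicit.
Unset Printing Implicit Defensive.

Import Order.TTheory GRing.Theory Num.Theory.

Record sgraph := SGraph {
  vertex :> finType;
  adj : rel vertex;
  adj_sym : symmetric adj;
  adj_irr : irreflexive adj
}.

Section Digraph.
Variables (V : finType) (arc : rel V).

Definition walk (u v : V) (n : nat) : bool :=
  [exists p : n.-tuple V, path arc u p && (last u p == v)].

Lemma connect_walk (u v : V) : connect arc u v -> exists n, walk u v n.
Proof.
case/connectP=> p arcp ->; exists (size p).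
by apply/existsP; exists (in_tuple p); rewrite arcp eqxx.
Qed.

(* Distances are natural numbers or +oo; they are valued in \bar int because
   the library provides its order and its arithmetic. *)
Definition dist (u v : V) : \bar int :=
  if @idP (connect arc u v) is ReflectT uv
  then ((ex_minn (connect_walk uv))%:Z)%:E%E else +oo%E.

Definition ecc (u : V) : \bar int := \big[maxe/-oo%E]_(v : V) dist u v.

Definition diam : \bar int :=
  \big[maxe/-oo%E]_(u : V) \big[maxe/-oo%E]_(v : V) dist u v.

Definition strong : bool := [forall u, forall v, connect arc u v].

End Digraph.

Definition connected_graph (G : sgraph) : bool :=
  [forall u, forall v, connect (@adj G) u v].

Definition radius (G : sgraph) : \bar int :=
  \big[mine/+oo%E]_(u : G) ecc (@adj G) u.

Definition arcs (V : finType) (D : {set V * V}) : rel V :=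
  [rel u v | (u, v) \in D].

Definition orientation (G : sgraph) (D : {set G * G}) : bool :=
  [forall u, forall v,
     if adj u v then ((u, v) \in D) (+) ((v, u) \in D) else (u, v) \notin D].

(* Equal to +oo when G has no strong orientation. *)
Definition diam_min (G : sgraph) : \bar int :=
  \big[mine/+oo%E]_(D : {set G * G} | orientation D && strong (arcs D))
     diam (arcs D).

Section StrongProduct.
Variables G H : sgraph.

Definition strong_adj : rel (G * H) := fun x y =>
  [|| (x.1 == y.1) && adj x.2 y.2,
      adj x.1 y.1 && (x.2 == y.2)
    | adj x.1 y.1 && adj x.2 y.2].

Lemma strong_adj_sym : symmetric strong_adj.
Proof.
move=> x y; rewrite /strong_adj (eq_sym x.1) (eq_sym x.2).
by rewrite (adj_sym x.1) (adj_sym x.2).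
Qed.

Lemma strong_adj_irr : irreflexive strong_adj.
Proof. by move=> x; rewrite /strong_adj !adj_irr !andbF. Qed.

Definition strong_product : sgraph := SGraph strong_adj_sym strong_adj_irr.

End StrongProduct.

Notation "G ⊠ H" := (strong_product G H) (at level 40, left associativity).

(* Main.v *)
(** Fix a vertex (c, d) of eccentricity r in the product, and let a and b be the
    distances to c in G and to d in H.  Call (x, y) even or odd according to the
    parity of a x + b y.  An edge joining vertices of different parity points to
    the even one; a diagonal edge, along which a and b vary together, points
    towards (c, d) between even vertices and away from it between odd ones.
    Even vertices thus run inwards, and odd ones are reached from inside, until
    a = 0 or b = 0; there, a zigzag between levels 0 and 1 of the vanishing
    coordinate preserves the parity and continues at speed one.  Hence every
    vertex reaches (c, d) in r + 1 steps.  Reversing the edge from (c, d) to a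
    neighbour (c1, d) gives access to the odd part, and every vertex is reached
    from (c1, d) in r + 2 steps, so that the diameter is at most 2 r + 4. *)

Require Import Defs.
From mathcomp Require Import all_boot all_order all_algebra.
From mathcomp Require Import constructive_ereal zify.

Set Implicit Arguments.
Unset Strict Implicit.
Unset Printing Implicit Defensive.

Import Order.TTheory GRing.Theory Num.Theory.

(** * Walks of bounded length and distances *)

Section Reach.
Variables (V : finType) (e : rel V).

Definition reach (n : nat) (u v : V) : Prop :=
  exists2 p, path e u p & last u p = v /\ size p <= n.

Lemma reach_refl n u : reach n u u.
Proof. by exists [::]. Qed.

Lemma reach_le m n u v : m <= n -> reach m u v -> reach n u v.
Proof. by move=> mn [p ep [lp sp]]; exists p => //; split=> //; lia. Qed.

Lemma reach_arc u v : e u v -> reach 1 u v.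
Proof. by move=> uv; exists [:: v]; rewrite //= uv. Qed.

Lemma reach_trans m n u v w : reach m u v -> reach n v w -> reach (m + n) u w.
Proof.
move=> [p ep [<- sp]] [q eq_ [<- sq]]; exists (p ++ q).
  by rewrite cat_path ep.
by rewrite last_cat size_cat leq_add.
Qed.

Lemma reach_connect n u v : reach n u v -> connect e u v.
Proof. by case=> p ep [lp _]; apply/connectP; exists p. Qed.

Lemma reach_dist n u v : reach n u v -> (dist e u v <= n%:Z%:E)%E.
Proof.
move=> r; rewrite /dist; case: {-}_ / idP => [uv|]; last first.
  by case; exact: reach_connect r.
case: r => p ep [lp sp]; case: ex_minnP => m _ min_m.
rewrite lee_fin lez_nat (leq_trans _ sp)// min_m//.
by apply/existsP; exists (in_tuple p); rewrite ep lp eqxx.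
Qed.

Lemma dist_reach u v : (dist e u v = +oo)%E \/
  exists2 n, dist e u v = n%:Z%:E%E & reach n u v.
Proof.
rewrite /dist; case: {-}_ / idP => [uv|]; last by left.
right; case: ex_minnP => m /existsP[p /andP[ep /eqP lp]] _; exists m => //.
by exists p => //; rewrite size_tuple.
Qed.

End Reach.

(* Equivalently, [a x] is the distance from [c] to [x] in [G]. *)
Definition level_function (G : sgraph) (c : G) (a : G -> nat) : Prop :=
  [/\ forall x, (a x == 0) = (x == c),
      forall x, 0 < a x -> exists2 y, adj x y & a x = (a y).+1
    & forall x y, adj x y -> a y <= (a x).+1].

Lemma level_function_exists (G : sgraph) (c : G) :
  connected_graph G -> exists a, level_function c a.
Proof.
move=> Gc; have cx x : connect (@adj G) c x by move/forallP/(_ c)/forallP: Gc.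
pose a x := ex_minn (connect_walk (cx x)).
have a_le x p : path (@adj G) c p -> last c p = x -> a x <= size p.
  rewrite /a; case: ex_minnP => m _ min_m pp lp; apply: min_m.
  by apply/existsP; exists (in_tuple p); rewrite pp lp eqxx.
have a_walk x : exists2 p, path (@adj G) c p & last c p = x /\ size p = a x.
  rewrite /a; case: ex_minnP => m /existsP[p /andP[pp /eqP lp]] _.
  by exists p => //; rewrite size_tuple.
have lip x y : adj x y -> a y <= (a x).+1.
  have [p pp [lp <-]] := a_walk x => xy.
  by rewrite -(size_rcons p y) a_le ?last_rcons// rcons_path pp lp.
exists a; split=> // x.
  apply/eqP/eqP => [ax0|->]; last first.
    by have := @a_le c [::] isT erefl; rewrite leqn0 => /eqP.
  by have [p _ [lp]] := a_walk x; rewrite ax0 => /size0nil p0; rewrite -lp p0.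
(* The parent of [x] is the last vertex but one on a shortest walk from [c]. *)
have [p pp [lp sp]] := a_walk x; move: sp; case/lastP: p pp lp => [_ _ <-//|p y].
rewrite rcons_path last_rcons size_rcons => /andP[pp py] yx sp _.
have xp : adj x (last c p) by rewrite adj_sym -yx.
exists (last c p) => //; apply/eqP; rewrite eqn_leq lip 1?adj_sym//=.
by rewrite -sp ltnS a_le.
Qed.

(** Follow parents down from any vertex other than [c]. This supplies the vertices [c1] and [d1] on
    which the zigzags turn. *)
Lemma level1_exists (G : sgraph) (c : G) a :
  level_function c a -> 1 < #|G| -> exists x, a x = 1.
Proof.
move=> [a0 par _] /card_gt1P[x [y [_ _ xy]]].
have [z zc] : exists z, z != c.
  case: (eqVneq x c) => xc; last by exists x.
  by exists y; rewrite -xc eq_sym.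
have : 0 < a z by rewrite lt0n a0.
have [n] := ubnP (a z); elim: n z {zc} => // n IH z zn z0.
have [w _ aw] := par z z0; case: (posnP (a w)) => w0; first by exists z; lia.
by apply: (IH w); lia.
Qed.

(** * Orientations extending a partial preference *)

Section OrientationOfRelation.
Variables (G : sgraph) (w : rel G).

(** Edges on which [w] is silent follow the enumeration of the vertices, so [w] need only decide the
    edges that matter. *)
Definition orient_along : {set G * G} :=
  [set uv | adj uv.1 uv.2 &&
     (w uv.1 uv.2 || ~~ w uv.2 uv.1 && (enum_rank uv.1 < enum_rank uv.2))].

Lemma orient_alongP :
  (forall u v, adj u v -> w u v -> ~~ w v u) -> orientation orient_along.
Proof.
move=> asym; apply/forallP=> u; apply/forallP=> v; rewrite !inE /= (adj_sym v u).
case: ifP => [uv|-> //]; have [vu vw] := (asym u v uv, asym v u).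
have {vu vw} : ~~ (w u v && w v u) by apply/negP=> /andP[/vu /negP].
have : enum_rank u != enum_rank v.
  by apply/eqP=> /enum_rank_inj uv'; rewrite uv' adj_irr in uv.
rewrite -(inj_eq val_inj) /= neq_ltn.
rewrite uv; case: (ltngtP (enum_rank u) (enum_rank v)) => //.
  by case: (w u v); case: (w v u).
by case: (w u v); case: (w v u).
Qed.

Lemma orient_along_arc u v : adj u v -> w u v -> arcs orient_along u v.
Proof. by move=> uv wuv; rewrite /arcs /= inE /= uv wuv. Qed.

End OrientationOfRelation.

(** * The orientation of the product and its short routes *)

Section Construction.
Variables (G H : sgraph) (c c1 : G) (d d1 : H) (a : G -> nat) (b : H -> nat).
Variable r : nat.
Hypotheses (levG : level_function c a) (levH : level_function d b).
Hypotheses (a_c1 : a c1 = 1) (b_d1 : b d1 = 1).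
Hypotheses (a_le : forall x, a x <= r) (b_le : forall y, b y <= r).

Definition odd_level (u : G ⊠ H) : bool := odd (a u.1 + b u.2).

(* In both cases the last two lines are the zigzags. The conditions on [c1]
   settle the edges between levels (1, 0) and (0, 1), which lie on both zigzags:
   they leave (c1, d), and enter the other vertices (x, d) with [a x = 1]. *)
Definition preferred : rel (G ⊠ H) := fun u v =>
  let: (i, j, k, l) := (a u.1, b u.2, a v.1, b v.2) in
  if odd_level u then
    [|| ~~ odd_level v && ~~ ((u == (c1, d)) && (v == (c, d))),
        (k == i.+1) && (l == j.+1),
        [&& i == 1, k == 0, l == j.+1 & (j != 0) || (u.1 == c1)]
      | [&& j == 1, l == 0, k == i.+1 & (i != 0) || (v.1 != c1)]]
  else
    [|| (u == (c, d)) && (v == (c1, d)),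
        (i == k.+1) && (j == l.+1),
        [&& i == 0, k == 1 & j == l.+1]
      | [&& j == 0, l == 1 & i == k.+1]].

Let D := orient_along preferred.
Let A : rel (G ⊠ H) := arcs D.

Lemma level0G x : a x = 0 -> x = c.
Proof. by case: levG => a0 _ _ /eqP; rewrite a0 => /eqP. Qed.

Lemma level0H y : b y = 0 -> y = d.
Proof. by case: levH => b0 _ _ /eqP; rewrite b0 => /eqP. Qed.

Lemma a_c : a c = 0.
Proof. by case: levG => a0 _ _; apply/eqP; rewrite a0. Qed.

Lemma b_d : b d = 0.
Proof. by case: levH => b0 _ _; apply/eqP; rewrite b0. Qed.

Lemma rootE (u : G ⊠ H) : (u == (c, d)) = (a u.1 == 0) && (b u.2 == 0).
Proof. by case: levG levH => a0 _ _ [b0 _ _]; rewrite a0 b0. Qed.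

Lemma hubE (u : G ⊠ H) : (u == (c1, d)) = (u.1 == c1) && (b u.2 == 0).
Proof. by case: levH => b0 _ _; rewrite b0. Qed.

(** Besides the four levels, only the tests against [c1] matter, and [c1] has level 1; what remains
    is linear arithmetic. *)
Lemma preferred_asym (u v : G ⊠ H) : preferred u v -> ~~ preferred v u.
Proof.
have e1 x : x == c1 -> a x = 1 by move=> /eqP->.
rewrite /preferred !rootE !hubE /odd_level.
have := e1 u.1; have := e1 v.1.
case: (u.1 == c1); case: (v.1 == c1) => /= h1 h2;
  try have {}h1 := h1 isT; try have {}h2 := h2 isT;
  move: (a u.1) (b u.2) (a v.1) (b v.2) h1 h2 => i j k l h1 h2;
  case: ifP => o1; case: ifP => o2; lia.
Qed.

Lemma preferred_arc (u v : G ⊠ H) : adj u v -> preferred u v -> A u v.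
Proof. exact: orient_along_arc. Qed.

Lemma parentG x : 0 < a x -> exists2 y, adj x y & a x = (a y).+1.
Proof. by case: levG => _ + _; apply. Qed.

Lemma parentH x : 0 < b x -> exists2 y, adj x y & b x = (b y).+1.
Proof. by case: levH => _ + _; apply. Qed.

(** The parent of a level 1 vertex has level 0, so it is [c]. The zigzags use these edges. *)
Lemma adj_level1G x y : a x = 0 -> a y = 1 -> adj x y.
Proof.
move=> /level0G -> ay; have [|z] := @parentG y; first by rewrite ay.
by rewrite ay adj_sym => yz [/esym/level0G zc]; rewrite -zc.
Qed.

Lemma adj_level1H x y : b x = 0 -> b y = 1 -> adj x y.
Proof.
move=> /level0H -> ay; have [|z] := @parentH y; first by rewrite ay.
by rewrite ay adj_sym => yz [/esym/level0H zc]; rewrite -zc.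
Qed.

Lemma adj_diag (x x' : G) (y y' : H) :
  adj x x' -> adj y y' -> @adj (G ⊠ H) (x, y) (x', y').
Proof. by move=> xx yy; rewrite /= /strong_adj /= xx yy !orbT. Qed.

Lemma adj_col (x : G) (y y' : H) : adj y y' -> @adj (G ⊠ H) (x, y) (x, y').
Proof. by move=> yy; rewrite /= /strong_adj /= eqxx yy. Qed.

Lemma adj_row (x x' : G) (y : H) : adj x x' -> @adj (G ⊠ H) (x, y) (x', y).
Proof. by move=> xx; rewrite /= /strong_adj /= xx eqxx orbT. Qed.

Lemma odd_even_arc (u v : G ⊠ H) : adj u v -> odd_level u -> ~~ odd_level v ->
  (u == (c1, d)) && (v == (c, d)) = false -> A u v.
Proof.
by move=> uv ou ov uv'; apply: preferred_arc => //; rewrite /preferred ou ov uv'.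
Qed.

(** Every step stays among even vertices and lowers the larger of the two levels by one. *)
Lemma reach_root_even (u : G ⊠ H) :
  ~~ odd_level u -> reach A (maxn (a u.1) (b u.2)) u (c, d).
Proof.
have [n] := ubnP (maxn (a u.1) (b u.2)); elim: n u => // n IH [x y] /=.
rewrite /odd_level /= => le_n ou.
have step x' y' : @adj (G ⊠ H) (x, y) (x', y') -> preferred (x, y) (x', y') ->
    ~~ odd (a x' + b y') -> maxn (a x) (b y) = (maxn (a x') (b y')).+1 ->
    reach A (maxn (a x) (b y)) (x, y) (c, d).
  move=> uv puv ov e; rewrite e -add1n; apply: (@reach_trans _ _ _ _ _ (x', y')).
    by apply/reach_arc/preferred_arc.
  by apply: IH => //=; lia.
have [ax|ax] := posnP (a x); have [bx|bx] := posnP (b y).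
- by rewrite (level0G ax) (level0H bx); exact: reach_refl.
(* By parity [b y] is at least 2, so raising the first level to 1 still lowers the maximum. *)
- have [y' yy' e] := parentH bx; apply: (step c1 y').
  + by apply: adj_diag => //; exact: adj_level1G.
  + by rewrite /preferred /odd_level /= (negbTE ou) ax a_c1 e !eqxx !orbT.
  + by lia.
  + by lia.
- have [x' xx' e] := parentG ax; apply: (step x' d1).
  + by apply: adj_diag => //; exact: adj_level1H.
  + by rewrite /preferred /odd_level /= (negbTE ou) bx b_d1 e !eqxx !orbT.
  + by lia.
  + by lia.
- have [x' xx' ex] := parentG ax; have [y' yy' ey] := parentH bx.
  apply: (step x' y'); first exact: adj_diag.
  + by rewrite /preferred /odd_level /= (negbTE ou) ex ey !eqxx !orbT.
  + by lia.
  + by lia.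
Qed.

Lemma reach_root (u : G ⊠ H) : reach A r.+1 u (c, d).
Proof.
have r_gt0 : 0 < r by rewrite -a_c1 a_le.
have [ou|ou] := boolP (odd_level u); last first.
  by apply: reach_le (reach_root_even ou); rewrite geq_max !leqW.
have step v : A u v -> ~~ odd_level v -> reach A r.+1 u (c, d).
  move=> uv ov; rewrite -add1n; apply: (reach_trans (reach_arc uv)).
  by apply: reach_le (reach_root_even ov); rewrite geq_max a_le b_le.
case: u ou step => x y; rewrite /odd_level /= => ou step.
have [by0|by0] := posnP (b y).
  have [|x' xx' e] := @parentG x; first by lia.
  (* The hub [(c1, d)] has no arc to the root; it leaves through the even vertex [(c1, d1)]. *)
  have [hub|hub] := eqVneq x c1.
    apply: (step (x, d1)); last by rewrite /odd_level /=; lia.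
    apply: odd_even_arc; rewrite ?rootE ?hubE /odd_level /=; try lia.
    by apply/adj_col/adj_level1H.
  apply: (step (x', y)); last by rewrite /odd_level /=; lia.
  apply: odd_even_arc; rewrite ?rootE ?hubE /odd_level /=; try lia.
  exact: adj_row.
have [y' yy' e] := parentH by0.
apply: (step (x, y')); last by rewrite /odd_level /=; lia.
apply: odd_even_arc; rewrite ?rootE ?hubE /odd_level /=; try lia.
exact: adj_col.
Qed.

(** The route is built backwards from [v], mirroring the even case. The extra step pays for the
    vertices [(x, d)] with [a x = 1] and [x] other than [c1], which lie two steps from the hub. *)
Lemma reach_hub_odd (v : G ⊠ H) :
  odd_level v -> reach A (maxn (a v.1) (b v.2)).+1 (c1, d) v.
Proof.
have [n] := ubnP (maxn (a v.1) (b v.2)); elim: n v => // n IH [x y] /=.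
rewrite /odd_level /= => le_n ov.
have step x' y' : @adj (G ⊠ H) (x', y') (x, y) -> preferred (x', y') (x, y) ->
    odd (a x' + b y') -> maxn (a x) (b y) = (maxn (a x') (b y')).+1 ->
    reach A (maxn (a x) (b y)).+1 (c1, d) (x, y).
  move=> uv puv ou e; rewrite -addn1; apply: (@reach_trans _ _ _ _ _ (x', y')).
    by rewrite e; apply: IH => //=; lia.
  by apply/reach_arc/preferred_arc.
have hub_row y1 : b y1 = 1 -> A (c1, d) (c, y1).
  move=> by1; apply: preferred_arc.
    rewrite adj_sym; apply: adj_diag; first by apply: adj_level1G; rewrite ?a_c.
    by rewrite adj_sym; apply: adj_level1H; rewrite ?b_d.
  by rewrite /preferred /odd_level /= a_c1 b_d a_c by1 !eqxx /= ?orbT.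
have [ax|ax] := posnP (a x); have [bx|bx] := posnP (b y).
- by move: ov; rewrite ax bx.
- have [y' yy' e] := parentH bx.
  have [by'|by'] := posnP (b y').
    rewrite (level0G ax); apply: (@reach_le _ _ 1); first by [].
    by apply/reach_arc/hub_row; rewrite e by'.
  apply: (step c1 y').
  + by rewrite adj_sym; apply: adj_diag => //; exact: adj_level1G.
  + by rewrite /preferred /odd_level /= a_c1 ax e (lt0n_neq0 by'); case: ifP; lia.
  + by lia.
  + by lia.
- have [x' xx' e] := parentG ax.
  have adj_d1 : @adj (G ⊠ H) (x', d1) (x, y).
    by rewrite adj_sym; apply: adj_diag => //; exact: adj_level1H.
  have [ax'|ax'] := posnP (a x').
    (* Arcs between levels (1, 0) and (0, 1) leave the hub and enter its peers, so [(c, d1)] links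
       them. *)
    rewrite (level0H bx); have [->|xc1] := eqVneq x c1; first exact: reach_refl.
    apply: (@reach_le _ _ (1 + 1)); first by lia.
    apply: (@reach_trans _ _ _ _ _ (c, d1)).
      exact/reach_arc/hub_row.
    apply: reach_arc; rewrite -(level0G ax') -(level0H bx).
    apply: preferred_arc => //.
    by rewrite /preferred /odd_level /= b_d1 ax' bx e ax' xc1 !eqxx !orbT.
  apply: (step x' d1) => //.
  + by rewrite /preferred /odd_level /= b_d1 bx e (lt0n_neq0 ax'); case: ifP; lia.
  + by lia.
  + by lia.
- have [x' xx' ex] := parentG ax; have [y' yy' ey] := parentH bx.
  apply: (step x' y'); first by rewrite adj_sym; exact: adj_diag.
  + by rewrite /preferred /odd_level /= ex ey; case: ifP; lia.
  + by lia.
  + by lia.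
Qed.

Lemma reach_hub (v : G ⊠ H) : reach A r.+2 (c1, d) v.
Proof.
have odd_reach u : odd_level u -> reach A r.+1 (c1, d) u.
  by move=> /reach_hub_odd; apply: reach_le; rewrite ltnS geq_max a_le b_le.
have [ov|ov] := boolP (odd_level v).
  by apply: reach_le (odd_reach v ov).
have step u : A u v -> odd_level u -> reach A r.+2 (c1, d) v.
  move=> uv ou; rewrite -[r.+2]addn1.
  exact: reach_trans (odd_reach u ou) (reach_arc uv).
case: v ov step => x y; rewrite /odd_level /= => ov step.
have [by0|by0] := posnP (b y).
  have [ax0|ax0] := posnP (a x).
    (* Here the target is the root, which is entered from [(c, d1)] because the hub has no arc to
       it. *)
    apply: (step (x, d1)); last by rewrite /odd_level /=; lia.
    apply: odd_even_arc; rewrite ?rootE ?hubE /odd_level /=; try lia.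
    by rewrite strong_adj_sym; apply/adj_col/adj_level1H.
  have [x' xx' e] := parentG ax0.
  apply: (step (x', y)); last by rewrite /odd_level /=; lia.
  apply: odd_even_arc; rewrite ?rootE ?hubE /odd_level /=; try lia.
  by rewrite strong_adj_sym; exact: adj_row.
have [y' yy' e] := parentH by0.
apply: (step (x, y')); last by rewrite /odd_level /=; lia.
apply: odd_even_arc; rewrite ?rootE ?hubE /odd_level /=; try lia.
by rewrite strong_adj_sym; exact: adj_col.
Qed.

(** This is the only arc from an even vertex to an odd one. *)
Lemma root_hub : A (c, d) (c1, d).
Proof.
apply: preferred_arc; first by apply/adj_row/adj_level1G; rewrite ?a_c.
by rewrite /preferred /odd_level /= a_c b_d !eqxx.
Qed.

Lemma short_orientation : exists2 D0 : {set (G ⊠ H) * (G ⊠ H)},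
  orientation D0 & forall u v, reach (arcs D0) (2 * r + 4) u v.
Proof.
exists D; first by apply: orient_alongP => u v _; exact: preferred_asym.
move=> u v; have -> : 2 * r + 4 = r.+1 + 1 + r.+2 by lia.
apply: reach_trans (reach_hub v).
exact: reach_trans (reach_root u) (reach_arc root_hub).
Qed.

End Construction.

(** * From levels to eccentricity and radius *)

(** Each step moves the level by at most one. With [f] a projection of the product, distances in the
    product bound both levels. *)
Lemma level_le_path (G : sgraph) (c : G) a : level_function c a ->
  forall (T : Type) (e : rel T) (f : T -> G),
  (forall u v, e u v -> (f u == f v) || adj (f u) (f v)) ->
  forall u p, path e u p -> a (f (last u p)) <= a (f u) + size p.
Proof.
move=> [_ _ lip] T e f ef u p; elim: p u => [|v p IH] u /=; first by rewrite addn0.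
move=> /andP[/ef uv /IH] le_p; apply: leq_trans le_p _.
rewrite addnS -addSn leq_add2r.
by case/orP: uv => [/eqP->//|]; exact: lip.
Qed.

(** Taking an arbitrary vertex as root avoids having to choose one that attains the radius. *)
Lemma diam_min_le_ecc (G H : sgraph) (z : G ⊠ H) : 1 < #|G| -> 1 < #|H| ->
  connected_graph G -> connected_graph H ->
  (diam_min (G ⊠ H) <= 2 * ecc (@adj (G ⊠ H)) z + 15)%E.
Proof.
case: z => c d G1 H1 Gc Hc.
have [a levG] := level_function_exists c Gc.
have [b levH] := level_function_exists d Hc.
have [c1 ac1] := level1_exists levG G1.
have [d1 bd1] := level1_exists levH H1.
have dist_le v : (dist (@adj (G ⊠ H)) (c, d) v <= ecc (@adj (G ⊠ H)) (c, d))%E.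
  exact: le_bigmax.
have level_le v n : reach (@adj (G ⊠ H)) n (c, d) v ->
    a v.1 <= n /\ b v.2 <= n.
  case=> p ep [<- sp].
  have [/eqP ac /eqP bd] : a c == 0 /\ b d == 0.
    by case: levG levH => -> _ _ [-> _ _]; rewrite !eqxx.
  split; apply: leq_trans sp.
    have := @level_le_path G c a levG _ _ fst _ _ _ ep; rewrite ac add0n; apply.
    by move=> u w /or3P[/andP[->]|/andP[->]|/andP[->]]; rewrite ?orbT.
  have := @level_le_path H d b levH _ _ snd _ _ _ ep; rewrite bd add0n; apply.
  by move=> u w /or3P[/andP[_ ->]|/andP[_ ->]|/andP[_ ->]]; rewrite ?orbT.
move: (dist_le) (dist_le (c, d)).
case: (ecc _ _) => [e||] {}dist_le; last 2 first.
- by move=> _; rewrite mulr_infty gtr0_sg// mul1e leey.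
(* The value [-oo] is excluded by the distance from the root to itself. *)
- case: (dist_reach (@adj (G ⊠ H)) (c, d) (c, d)) => [->|[n ->]] //.
move=> dist0.
have [r er] : exists r : nat, e = (r%:Z)%R.
  exists (absz e).
  case: (dist_reach (@adj (G ⊠ H)) (c, d) (c, d)) dist0 => [->|[n -> _]] //.
  by rewrite lee_fin => ne; lia.
have dist_r v : reach (@adj (G ⊠ H)) r (c, d) v.
  have := dist_le v; case: (dist_reach (@adj (G ⊠ H)) (c, d) v) => [->|[n -> rn]] //.
  by rewrite er lee_fin lez_nat => nr; exact: reach_le nr rn.
have a_le x : a x <= r by have [] := level_le _ _ (dist_r (x, d)).
have b_le y : b y <= r by have [] := level_le _ _ (dist_r (c, y)).
have [D oD reachD] := short_orientation levG levH ac1 bd1 a_le b_le.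
have bound : (diam (arcs D) <= (2 * r + 4)%:Z%:E)%E.
  apply: bigmax_le => [|u _]; first exact: leNye.
  apply: bigmax_le => [|v _]; first exact: leNye.
  exact: reach_dist.
apply: le_trans (le_trans bound _); last by rewrite er lee_fin; lia.
apply: bigmin_le_cond; rewrite oD; apply/forallP=> u; apply/forallP=> v.
exact: reach_connect (reachD u v).
Qed.

Theorem corollary3p2 (G H : sgraph)
    (G_nontrivial : 1 < #|G|) (H_nontrivial : 1 < #|H|)
    (G_connected : connected_graph G) (H_connected : connected_graph H) :
  (diam_min (G ⊠ H) <= 2 * radius (G ⊠ H) + 15)%E.
Proof.
(* The bound holds for the default [+oo] and for each eccentricity, and a minimum of two values is
   one of them. *)
rewrite /radius; elim/big_ind: _ => [|x y dx dy|z _].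
- by rewrite mulr_infty gtr0_sg// mul1e leey.
- by rewrite /mine; case: ifP.
- exact: diam_min_le_ecc.
Qed.
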